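(* Let $\lambda$ be a dominant integral weight of a simple Lie algebra $\mathfrak{g}$ and $\mu$ a weight such that $\mathcal{A}(\lambda,\mu)$ is nonempty. Then (1) there exists a unique subset $S\subseteq \mathcal{A}(\lambda,\mu)$ with $1\notin S$ such that each $b\in S$ has connected influence and any element $\sigma\in \mathcal{A}(\lambda,\mu)$ can be written as a product of elements from a (possibly empty) pairwise independent subset of $S$; and (2) there is a bijection between elements of $\mathcal{A}(\lambda,\mu)$ and pairwise independent subsets of $S$. In particular, each pairwise independent subset of $S$ corresponds to the element of $\mathcal{A}(\lambda,\mu)$ that can be written as the product of the elements of the subset.
   Context: $\mathfrak{g}$ is a finite-dimensional simple Lie algebra over $\mathbb{C}$ of rank $r\ge 1$, with simple roots $\alpha_1,\dots,\alpha_r$, positive roots $\Phi^+$, $\rho=\frac12\sum_{\alpha\in\Phi^+}\alpha$, and Weyl group $W$ (identity $1$) generated by the simple reflections $s_1,\dots,s_r$. $\wp(\xi)$ (Kostant's partition function) is the number of ways of expressing $\xi$ as a linear combination of the positive roots with nonnegative integer coefficients. For integral weights $\lambda,\mu$, $\mathcal{A}(\lambda,\mu)=\{\sigma\in W : \wp(\sigma(\lambda+\rho)-\mu-\rho)>0\}$. The influence of $\sigma\in W$ is $I(\sigma)=\{i : s_i \text{ is in a reduced word for } \sigma\}$, and its extended influence is $\overline{I}(\sigma)=\{i : i\in I(\sigma)\text{ or } i \text{ is adjacent to some } j\in I(\sigma) \text{ in the Dynkin diagram}\}$. $I(\sigma)$ is connected if the subgraph of the Dynkin diagram it induces is connected.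 Elements $\sigma,\tau\in W$ are independent if $I(\sigma)\cap\overline{I}(\tau)=\emptyset$. A set $B\subseteq W$ is pairwise independent if any two elements $\sigma\ne\tau$ of $B$ are independent. Independent elements commute, so the product of the elements of a pairwise independent set is well defined; the empty product is $1$. *)

(* Defs.v *)
From mathcomp Require Import all_boot all_order all_algebra.
From mathcomp Require Import finmap.
From mathcomp Require Import boolp classical_sets functions cardinality reals.
From mathcomp Require Import complex.

Set Implicit Arguments.
Unset Strict Implicit.
Unset Printing Implicit Defensive.

Import Order.TTheory GRing.Theory Num.Theory.
Local Open Scope classical_set_scope.
Local Open Scope ring_scope.

Record liealg (K : fieldType) := LieAlg {
  lie_space :> vectType K;
  brk : lie_space -> lie_space -> lie_space;
  brk_linearl : forall c x y z, brk (c *: x + y) z = c *: brk x z + brk y z;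
  brk_linearr : forall c x y z, brk x (c *: y + z) = c *: brk x y + brk x z;
  brkxx : forall x, brk x x = 0;
  brk_jacobi : forall x y z,
    brk x (brk y z) + brk y (brk z x) + brk z (brk x y) = 0 }.

Definition lie_ideal (K : fieldType) (g : liealg K) (U : {vspace g}) : Prop :=
  forall x u : g, u \in U -> brk x u \in U.

Definition lie_simple (K : fieldType) (g : liealg K) : Prop :=
  (exists x y : g, brk x y != 0) /\
  (forall U : {vspace g}, lie_ideal U -> U = 0%VS \/ U = fullv).

Definition ad_diagonalizable (K : fieldType) (g : liealg K) (h : g) : Prop :=
  exists2 e : seq g, basis_of fullv e &
    forall x, x \in e -> exists c : K, brk h x = c *: x.

(* Cartan subalgebra in the usual sense for a semisimple complex Lie algebra:
   commutative, self-centralizing, acting diagonalizably. *)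
Definition cartan_subalgebra (K : fieldType) (g : liealg K)
    (H : {vspace g}) : Prop :=
  [/\ forall h h' : g, h \in H -> h' \in H -> brk h h' = 0,
      forall x : g, (forall h, h \in H -> brk h x = 0) -> x \in H &
      forall h : g, h \in H -> ad_diagonalizable h].

Definition dual (K : fieldType) (g : liealg K) (H : {vspace g}) : vectType K :=
  'Hom(subvs_of H, K^o).

Section Roots.
Context (K : fieldType) (g : liealg K) (H : {vspace g}).
Implicit Types (al la xi : dual H) (x y : g) (h : subvs_of H).

Definition pairing la h : K := (la : 'Hom(subvs_of H, K^o)) h.

Definition root_space al : set g :=
  [set x | forall h, brk (vsval h) x = pairing al h *: x].

Definition is_root al : Prop :=
  al != 0 /\ exists2 x, root_space al x & x != 0.

Definition is_coroot al h : Prop :=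
  pairing al h = 2 /\
  exists x y, [/\ root_space al x, root_space (- al) y & vsval h = brk x y].

(* For a root of a simple complex Lie algebra there is exactly one h such that
   is_coroot al h; xget picks it. *)
Definition coroot al : subvs_of H := xget 0 (is_coroot al).

Definition integral la : Prop :=
  forall al, is_root al -> exists m : int, pairing la (coroot al) = m%:~R.

Definition reflection al : 'End(dual H) :=
  linfun (fun la => la - pairing la (coroot al) *: al).

End Roots.

Section SimpleRoots.
Context (K : fieldType) (g : liealg K) (H : {vspace g}).
Context (r : nat) (a : 'I_r -> dual H).
Implicit Types (al la mu xi : dual H) (s t : 'End(dual H)).
Implicit Types (i j : 'I_r) (w : seq 'I_r) (I : set 'I_r).
Implicit Types (B S : set 'End(dual H)).

(* The first clause makes r the rank of g. *)
Definition simple_roots : Prop :=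
  [/\ basis_of fullv [tuple a i | i < r],
      forall i, is_root (a i) &
      forall al, is_root al -> exists c : 'I_r -> nat,
        al = \sum_(i < r) a i *+ c i \/ al = - (\sum_(i < r) a i *+ c i)].

Definition positive_root al : Prop :=
  is_root al /\ exists c : 'I_r -> nat, al = \sum_(i < r) a i *+ c i.

(* There are finitely many roots, so fset_set does not take its default value
   here, and neither does it in kostant below. *)
Definition positive_roots : {fset dual H} := fset_set positive_root.

Definition rho : dual H := 2^-1 *: \sum_(al <- positive_roots) al.

Definition kostant xi : nat :=
  #|` fset_set [set c : {ffun positive_roots -> nat} |
        \sum_(al : positive_roots) val al *+ c al = xi] |.

Definition dominant_integral la : Prop :=
  integral la /\ forall i, exists n : nat, pairing la (coroot (a i)) = n%:R.

Definition word_prod w : 'End(dual H) :=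
  \big[(@comp_lfun K _ _ _) / \1%VF]_(i <- w) reflection (a i).

Definition weyl_group : set 'End(dual H) := [set s | exists w, word_prod w = s].

Definition reduced_word s w : Prop :=
  word_prod w = s /\ forall w', word_prod w' = s -> (size w <= size w')%N.

Definition alt_set la mu : set 'End(dual H) :=
  [set s | weyl_group s /\ (0 < kostant (s (la + rho) - mu - rho)%R)%N].

(* a_ij a_ji, the number of edges of the Dynkin diagram joining i and j, is
   nonzero. *)
Definition adjacent i j : bool :=
  (i != j) &&
  (pairing (a i) (coroot (a j)) * pairing (a j) (coroot (a i)) != 0).

Definition influence s : set 'I_r :=
  [set i | exists2 w, reduced_word s w & i \in w].

Definition ext_influence s : set 'I_r :=
  [set i | influence s i \/ exists2 j, influence s j & adjacent i j].

Definition induces_connected I : Prop :=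
  forall i j, I i -> I j ->
    connect [rel k l | [&& k \in I, l \in I & adjacent k l]] i j.

Definition independent s t : Prop := influence s `&` ext_influence t = set0.

Definition pairwise_independent B : Prop :=
  forall s t, B s -> B t -> s <> t -> independent s t.

(* s is the product of the elements of the finite set B, whichever order the
   factors are taken in. *)
Definition is_product B s : Prop :=
  finite_set B /\
  forall l : seq 'End(dual H), uniq l -> [set` l] = B ->
    \big[(@comp_lfun K _ _ _) / \1%VF]_(t <- l) t = s.

Definition independent_subsets S : set (set 'End(dual H)) :=
  [set B | B `<=` S /\ pairwise_independent B].

Definition basic_subset la mu S : Prop :=
  [/\ S `<=` alt_set la mu,
      ~ S \1%VF,
      forall b, S b -> induces_connected (influence b) &
      forall s, alt_set la mu s ->
        exists2 B, independent_subsets S B & is_product B s].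

End SimpleRoots.

(* Main.v *)
From HB Require Import structures.
Require Import Defs.
From mathcomp Require Import all_boot all_order all_algebra.
From mathcomp Require Import finmap.
From mathcomp Require Import boolp classical_sets functions cardinality reals.
From mathcomp Require Import complex.
From mathcomp Require Import ring zify.

Set Implicit Arguments.
Unset Strict Implicit.
Unset Printing Implicit Defensive.

Import Order.TTheory GRing.Theory Num.Theory.
Import passmx.
Local Open Scope classical_set_scope.
Local Open Scope ring_scope.

(** Why the theorem is true. Let [lr = la + rho]; it is dominant and regular,
    its pairings with the simple coroots being positive integers. For [t] in the
    Weyl group write [lr - t lr = sum_i d_i(t) a_i], the [descent] of [t]. Three
    facts turn the theorem into a statement on these coordinates.

    - The [d_i(t)] are nonnegative integers, and [d_i(t) > 0] exactly when [i]
      is in the influence of [t]. Along a reduced word, each letter [j] adds a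
      positive multiple of a positive root, and that root has [a_j]-coefficient
      one when [j] is read for the first time ([reduced_descent]). So the
      influence is the support of the descent, and the descent determines [t],
      as the stabilizer of [lr] is trivial ([weyl_descent_inj]).
    - Since [t lr - mu - rho = (la - mu) - (lr - t lr)], an element [t] is in
      the alternation set iff [d_i(t)] is at most the [i]-th coordinate of
      [la - mu], for all [i], with an integral difference ([alt_setP]).
    - If [t] and [t'] are independent then [t] fixes the simple roots occurring
      in [lr - t' lr], so descents add up: [d(t t') = d(t) + d(t')]
      ([independent_descent]), with disjoint supports. So a product of
      independent elements is in the alternation set iff every factor is
      ([alt_set_comp_list]).

    Splitting a reduced word along a connected component of its support and
    iterating writes every element as a product of independent factors that are
    nontrivial with connected influence ([connected_factorization]). Their
    influences are the connected components of the influence of the product, and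
    their descents its restrictions, so the factors are unique
    ([connected_factors_sub]). Hence [S] has to be the set of nontrivial
    elements of the alternation set with connected influence, and taking the
    product is the bijection.

    The first half of the file establishes what this uses about the roots of
    [g], starting from the bracket. Every root has a coroot: the radical of the
    Killing form is an ideal, and it is not all of [g] because the form is
    positive on an element of [H] taking integral values on the roots; and a
    root vector [x] and a vector [y] dual to it whose bracket [t] is killed by
    the root would span a Heisenberg algebra, forcing [t] to be killed by every
    weight, hence orthogonal to [H], and the root to vanish ([coroot_exists]). Then strings of root vectors, as for sl2, show
    that simple reflections permute the roots and that no [k a_i], [k >= 2], is
    a root. From there on, only reflections, the finiteness of the set of roots
    and their signs matter. *)

(** * Common eigenbases *)

Lemma free_vecof (K : fieldType) (V : vectType K) (b e : (\dim {:V}).-tuple V)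
    (P : 'M[K]_(\dim {:V})) :
  basis_of fullv b -> (forall i : 'I__, rVof b e`_i = row i P) ->
  free e = row_free P.
Proof.
move=> bP eE.
have sumE (k : 'I__ -> K) : rVof b (\sum_i k i *: e`_i) = (\row_i k i) *m P.
  rewrite linear_sum mulmx_sum_row; apply: eq_bigr => i _.
  by rewrite linearZ /= eE mxE.
apply/freeP/idP => [fr|fr k k0 i].
  apply: inj_row_free => v vP; apply/rowP => i; rewrite mxE.
  apply: fr; apply/eqP; rewrite -(rVof_eq0 bP) sumE.
  by rewrite (_ : \row_i v 0 i = v) ?vP //; apply/rowP => j; rewrite mxE.
have := sumE k; rewrite k0 linear0 -(mul0mx _ P) => /(row_free_inj fr)/rowP/(_ i).
by rewrite !mxE.
Qed.

(** The matrices of the endomorphisms in a fixed basis are simultaneously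
    diagonalized by a matrix [P], whose rows are the coordinates of [e]. *)
Lemma common_eigenbasis (K : fieldType) (V : vectType K) (fs : seq 'End(V)) :
  {in fs &, forall f h, (f \o h = h \o f)%VF} ->
  (forall f, f \in fs -> exists2 e : seq V, basis_of fullv e &
     forall x, x \in e -> exists c, f x = c *: x) ->
  exists2 e : (\dim {:V}).-tuple V, basis_of fullv e &
    forall f, f \in fs -> forall j : 'I_(\dim {:V}), exists c, f e`_j = c *: e`_j.
Proof.
move=> fC fD.
set n := \dim {:V}; pose b := vbasis {:V}; have bP : basis_of {:V} b := vbasisP _.
have [P Pu /allP PD] : codiagonalizable [seq mxof b b f | f <- fs].
  apply/codiagonalizableP; split.
    move=> A B /mapP[f fi ->] /mapP[h hi ->].
    by rewrite /comm_mx -!(mxof_comp _ _ bP) fC.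
  move=> A /mapP[f /fD[e eP eE] ->].
  have se : size e == n by rewrite /n (size_basis (X := in_tuple e) eP).
  pose t := Tuple se; pose P : 'M_n := \matrix_(i < n) rVof b t`_i.
  have Pu : P \in unitmx.
    rewrite -row_free_unit -(free_vecof (b := b) (e := t)) //.
      exact: (basis_free eP).
    by move=> i; rewrite rowK.
  exists P => //.
  have /fin_all_exists[c cE] (i : 'I_n) : exists c, f t`_i = c *: t`_i.
    by apply: eE; apply: mem_nth; rewrite size_tuple.
  apply/diagonalizable_forPex; exists (\row_i c i); apply/simmxP => //.
  apply/row_matrixP => i; rewrite !row_mul row_diag_mx -scalemxAl -rowE rowK mxE.
  by rewrite -(rVof_app b bP) cE linearZ.
pose e := [tuple vecof b (row i P) | i < n].
have eE (i : 'I_n) : e`_i = vecof b (row i P).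
  by rewrite -(tnth_nth 0 e) tnth_mktuple.
have ef : free e.
  rewrite (free_vecof (b := b) (P := P)) ?row_free_unit //.
  by move=> i; rewrite eE vecofK.
exists e; first by rewrite basisEfree ef subvf size_tuple leqnn.
move=> f fi j.
have /PD/= /diagonalizable_forPex[d /(simmxP Pu) dE] : mxof b b f \in [seq mxof b b f | f <- fs].
  exact: map_f.
exists (d 0 j); rewrite eE (hom_vecof _ bP) -row_mul dE row_mul row_diag_mx -scalemxAl.
by rewrite -rowE linearZ.
Qed.

(** * Brackets, weights and root spaces *)

Section LieBasics.
Context (K : fieldType) (g : liealg K).
Implicit Types x y z : g.

Fact brk_is_linear x : linear (@brk K g x).
Proof. by move=> c y z; rewrite brk_linearr. Qed.
HB.instance Definition _ x :=
  GRing.isLinear.Build K g g _ (@brk K g x) (brk_is_linear x).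

Lemma brkDl x y z : brk (x + y) z = brk x z + brk y z.
Proof. by rewrite -[x in LHS]scale1r brk_linearl scale1r. Qed.

Lemma brkC x y : brk x y = - brk y x.
Proof.
apply/eqP; rewrite -addr_eq0; apply/eqP.
by have := brkxx (x + y); rewrite linearD /= !brkDl !brkxx add0r addr0 addrC.
Qed.

Lemma brkZl c x z : brk (c *: x) z = c *: brk x z.
Proof. by rewrite brkC linearZ /= -scalerN -brkC. Qed.

Lemma brkNl x z : brk (- x) z = - brk x z.
Proof. by rewrite -scaleN1r brkZl scaleN1r. Qed.

Lemma brk0l z : @brk K g 0 z = 0.
Proof. by rewrite brkC linear0 oppr0. Qed.

Lemma brk_deriv x y z : brk x (brk y z) = brk (brk x y) z + brk y (brk x z).
Proof.
have /eqP := brk_jacobi x y z; rewrite -addrA addr_eq0 => /eqP ->.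
by rewrite (brkC z x) (brkC z (brk x y)) linearN opprD !opprK addrC.
Qed.
End LieBasics.

Section Weights.
Context (K : numFieldType) (g : liealg K) (H : {vspace g}).
Implicit Types (x y z : g) (al be la : dual H) (h : subvs_of H).

Lemma pairingE la h : pairing la h = (la : 'Hom(subvs_of H, K^o)) h.
Proof. by []. Qed.

Lemma pairing0 h : pairing (0 : dual H) h = 0.
Proof. by rewrite pairingE lfunE. Qed.

Lemma pairingD al be h : pairing (al + be) h = pairing al h + pairing be h.
Proof. by rewrite pairingE add_lfunE. Qed.

Lemma pairingN al h : pairing (- al) h = - pairing al h.
Proof. by rewrite pairingE opp_lfunE. Qed.

Lemma pairingZ c al h : pairing (c *: al) h = c * pairing al h.
Proof. by rewrite pairingE scale_lfunE. Qed.

Lemma pairingMn al n h : pairing (al *+ n) h = pairing al h *+ n.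
Proof. by rewrite -scaler_nat pairingZ mulr_natl. Qed.

Lemma pairing_sum I (r : seq I) (P : pred I) (F : I -> dual H) h :
  pairing (\sum_(i <- r | P i) F i) h = \sum_(i <- r | P i) pairing (F i) h.
Proof. by rewrite pairingE sum_lfunE. Qed.

Lemma pairingZr la c h : pairing la (c *: h) = c * pairing la h.
Proof. by rewrite !pairingE linearZ. Qed.

Lemma pairing_sumr la I (r : seq I) (P : pred I) (F : I -> subvs_of H) :
  pairing la (\sum_(i <- r | P i) F i) = \sum_(i <- r | P i) pairing la (F i).
Proof. by rewrite pairingE linear_sum. Qed.

Lemma pairingNr la h : pairing la (- h) = - pairing la h.
Proof. by rewrite !pairingE linearN. Qed.

Lemma pairing_inj al be : (forall h, pairing al h = pairing be h) -> al = be.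
Proof. by move=> E; apply/lfunP. Qed.

Lemma root_space_brk al be x y :
  root_space al x -> root_space be y -> root_space (al + be) (brk x y).
Proof.
move=> xa yb h; rewrite brk_deriv xa yb brkZl linearZ /= -scalerDl.
by rewrite pairingD.
Qed.

Lemma root_spaceZ al c x : root_space al x -> root_space al (c *: x).
Proof. by move=> xa h; rewrite linearZ /= xa !scalerA mulrC. Qed.

Context (n : nat) (e : n.-tuple g) (wt : 'I_n -> dual H).
Hypothesis eP : basis_of fullv e.
Hypothesis wtP : forall j, root_space (wt j) e`_j.

(** In the expansion of [x] on a basis of weight vectors, [h] scales the [j]-th
    term by [wt j h] and the whole sum by [al h]; so a nonzero term has weight
    [al]. *)
Lemma weight_mem al x : root_space al x -> x != 0 -> exists j, wt j = al.
Proof.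
move=> xa x0.
have [j xj] : exists j, coord e j x != 0.
  apply/existsP; apply: contraNT x0; rewrite negb_exists => /forallP x0.
  rewrite [x](coord_basis eP) ?memvf // big1 // => i _.
  by move: (x0 i); rewrite negbK => /eqP ->; rewrite scale0r.
exists j; apply: pairing_inj => h; apply: (mulIf xj).
have {1}-> : x = \sum_i coord e i x *: e`_i by rewrite -(coord_basis eP) ?memvf.
have := congr1 (coord e j) (xa h).
rewrite [in LHS](coord_basis eP (memvf x)) linear_sum /= linear_sum /=.
under eq_bigr do rewrite linearZ /= wtP scalerA linearZ /= (coord_free _ _ (basis_free eP)).
rewrite (bigD1 j) //= eqxx big1 ?addr0; last first.
  by move=> i /negbTE ->; rewrite mulr0.
rewrite linearZ /= mulr1 mulrC => <-.
by rewrite coord_sum_free ?(basis_free eP).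
Qed.
End Weights.

Section WeightBasis.
Context (K : numFieldType) (g : liealg K) (H : {vspace g}).
Implicit Types (x y z : g) (al be la : dual H) (h : subvs_of H).

Section WeightOf.
Context (n : nat) (e : n.-tuple g).

(** When [e`_j] is a common eigenvector of the [ad h], the eigenvalue as a
    function of [h]. Reading it off as a coordinate makes its linearity plain. *)
Definition weight_coord (j : 'I_n) h : K^o := coord e j (brk (vsval h) e`_j).

Fact weight_coord_linear j : linear (weight_coord j).
Proof. by move=> c h h'; rewrite /weight_coord linearP brk_linearl linearP. Qed.
HB.instance Definition _ j :=
  GRing.isLinear.Build K (subvs_of H) K^o _ (weight_coord j)
    (weight_coord_linear j).
End WeightOf.

Lemma weight_basis : cartan_subalgebra H ->
  exists e : (\dim {:g}).-tuple g, exists wt : 'I_(\dim {:g}) -> dual H,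
    basis_of fullv e /\ forall j, root_space (wt j) e`_j.
Proof.
case=> HC _ HD.
pose ad x : 'End(g) := linfun (@brk K g x).
pose hs := [seq ad t | t <- vbasis H].
have [f h /mapP[x xH ->] /mapP[y yH ->]|f /mapP[t tH ->]|e eP eD] :=
    @common_eigenbasis K g hs.
- apply/lfunP => z; rewrite !comp_lfunE !lfunE /=.
  by rewrite brk_deriv (HC x y) ?vbasis_mem // brk0l add0r.
- have [b bP bD] := HD t (vbasis_mem tH); exists b => // x /bD[c cE].
  by exists c; rewrite lfunE.
exists e; exists (fun j => linfun (weight_coord e j)); split=> // j h.
rewrite /pairing lfunE /=.
suff [c cE] : exists c, brk (vsval h) e`_j = c *: e`_j.
  by rewrite /weight_coord cE linearZ /= coord_free ?(basis_free eP) // eqxx mulr1.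
have /fin_all_exists[c cE] (i : 'I_(\dim H)) :
    exists c, brk (vbasis H)`_i e`_j = c *: e`_j.
  have [c cE] := eD (ad (vbasis H)`_i) (map_f _ (memt_nth _ _ (ltn_ord i))) j.
  by exists c; rewrite -cE lfunE.
exists (\sum_i coord (vbasis H) i (vsval h) * c i).
rewrite {1}(coord_vbasis (subvsP h)) brkC linear_sum -sumrN scaler_suml.
by apply: eq_bigr => i _; rewrite -brkC brkZl cE scalerA.
Qed.

Lemma root_space0 x : cartan_subalgebra H -> root_space (0 : dual H) x -> x \in H.
Proof.
case=> _ HZ _ x0; apply: HZ => h hH.
by have := x0 (Subvs hH); rewrite pairing0 scale0r.
Qed.

Lemma root_space_finite : cartan_subalgebra H ->
  exists l : seq (dual H), forall al x, root_space al x -> x != 0 -> al \in l.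
Proof.
move=> /weight_basis[e [wt [eP wtP]]]; exists (codom wt) => al x xa x0.
by have [j <-] := weight_mem eP wtP xa x0; apply: codom_f.
Qed.
End WeightBasis.

(** * Strings of root vectors *)

(** In characteristic zero the points [v + k u] are pairwise distinct as soon as
    [u] is nonzero. This is how the finiteness of the set of roots is used. *)
Lemma arith_progression_finite (K : numFieldType) (V : lmodType K) (l : seq V) (v u : V) :
  (forall k : nat, v + u *+ k \in l) -> u = 0.
Proof.
move=> vl; apply: contrapT => /eqP u0.
pose s := [seq v + u *+ k | k <- iota 0 (size l).+1].
have su : uniq s.
  rewrite map_inj_uniq ?iota_uniq // => i j /addrI /eqP.
  by rewrite -subr_eq0 -!scaler_nat -scalerBl scaler_eq0 (negbTE u0) orbF subr_eq0
    eqr_nat => /eqP.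
have sl : {subset s <= l} by move=> x /mapP[k _ ->].
by have := uniq_leq_size su sl; rewrite size_map size_iota ltnn.
Qed.

Section Strings.
Context (K : numFieldType) (g : liealg K) (H : {vspace g}).
Implicit Types (x y z : g) (al be : dual H) (t : subvs_of H).

Lemma root_space_iter al be y z k : root_space al y -> root_space be z ->
  root_space (be + al *+ k) (iter k (brk y) z).
Proof.
move=> ya zb; elim: k => [|k IH] /=; first by rewrite addr0.
by rewrite mulrS addrCA; apply: root_space_brk.
Qed.

Lemma iter_brk0 (y : g) k : iter k (brk y) 0 = 0.
Proof. by elim: k => //= k ->; rewrite linear0. Qed.

Lemma iter_brk_last al be y z : cartan_subalgebra H ->
  al != 0 -> root_space al y -> root_space be z -> z != 0 ->
  exists m, iter m (brk y) z != 0 /\ iter m.+1 (brk y) z = 0.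
Proof.
move=> Hc al0 ya zb z0.
have [l lP] := root_space_finite Hc.
have ex0 : exists k, iter k (brk y) z == 0.
  apply: contrapT => no; move/eqP: al0; apply.
  apply: (@arith_progression_finite _ _ l be) => k.
  apply: (lP _ (iter k (brk y) z)); first exact: root_space_iter.
  by apply/negP => k0; apply: no; exists k.
case: (ex_minnP ex0) => -[|m] /eqP m0 mmin; first by case/eqP: z0.
by exists m; split=> //; apply/negP => /mmin; rewrite ltnn.
Qed.

(** The commutation formula behind the representation theory of sl2, in a form
    that covers both an sl2-triple ([c = 2]) and a Heisenberg triple
    ([c = 0]). *)
Lemma raise_lower (x y t z : g) (c n : K) k :
  brk x y = t -> brk t y = - c *: y -> brk t z = n *: z -> brk x z = 0 ->
  brk x (iter k.+1 (brk y) z) = k.+1%:R * (n - c * k%:R / 2) *: iter k (brk y) z.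
Proof.
move=> xy ty tz xz.
have tk j : brk t (iter j (brk y) z) = (n - c * j%:R) *: iter j (brk y) z.
  elim: j => [|j IH] /=; first by rewrite mulr0 subr0.
  rewrite brk_deriv ty IH brkZl linearZ /= -scalerDl; congr (_ *: _).
  by rewrite -natr1; ring.
elim: k => [|k IH].
  by rewrite /= brk_deriv xy xz linear0 addr0 tz; congr (_ *: _); field.
rewrite iterS brk_deriv xy tk IH linearZ /= -scalerDl; congr (_ *: _).
by rewrite -!natr1; field.
Qed.

(** An [al]-string is as long as its highest weight dictates: lowering reaches
    zero exactly when the scalar of the commutation formula vanishes. *)
Lemma highest_weight_string al be x y z t : cartan_subalgebra H -> al != 0 ->
  root_space al x -> root_space (- al) y -> brk x y = vsval t ->
  root_space be z -> z != 0 -> brk x z = 0 ->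
  exists m : nat, pairing be t = pairing al t * m%:R / 2 /\
    forall k, (k <= m)%N -> iter k (brk y) z != 0.
Proof.
move=> Hc al0 xa ya xy zb z0 xz.
have al0' : - al != 0 by rewrite oppr_eq0.
have [m [m0 m1]] := iter_brk_last Hc al0' ya zb z0.
exists m; split.
  have := raise_lower m xy _ (zb t) xz.
  rewrite m1 linear0 => /(_ (pairing al t)) E.
  have /esym/eqP := E (etrans (ya t) (congr1 (fun u => u *: y) (pairingN al t))).
  rewrite scaler_eq0 (negbTE m0) orbF mulf_eq0 pnatr_eq0 /= subr_eq0.
  by move/eqP.
move=> k km; apply/negP => /eqP k0; move/negP: m0; apply.
by rewrite -(subnK km) iterD k0 iter_brk0.
Qed.

Lemma string_top al be x z : cartan_subalgebra H -> al != 0 ->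
  root_space al x -> root_space be z -> z != 0 ->
  exists p z', [/\ root_space (be + al *+ p) z', z' != 0 & brk x z' = 0].
Proof.
move=> Hc al0 xa zb z0; have [p [p0 p1]] := iter_brk_last Hc al0 xa zb z0.
by exists p, (iter p (brk x) z); split=> //; apply: root_space_iter.
Qed.

(** When [al t = 0], the element [t] acts on the whole string by one scalar; the
    string being finite, the commutation formula forces this scalar to be 0. *)
Lemma heisenberg_weight0 al be x y z t : cartan_subalgebra H -> al != 0 ->
  root_space al x -> root_space (- al) y -> brk x y = vsval t ->
  pairing al t = 0 -> root_space be z -> z != 0 -> pairing be t = 0.
Proof.
move=> Hc al0 xa ya xy at0 zb z0.
have [p [z' [zb' z0' xz]]] := string_top Hc al0 xa zb z0.
have [m [+ _]] := highest_weight_string Hc al0 xa ya xy zb' z0' xz.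
by rewrite pairingD pairingMn at0 mul0rn addr0 !mul0r.
Qed.

Lemma is_root_neq0 al : is_root al -> al != 0. Proof. by case. Qed.

(** The top of the [al]-string through [be] has weight [be + p al], and the
    string goes down [m] steps with [m = pairing be t + 2p]; so it contains
    [be - pairing be t al] as soon as [p <= m]. *)
Lemma refl_root_upper al be x y t : cartan_subalgebra H ->
  root_space al x -> root_space (- al) y -> brk x y = vsval t ->
  pairing al t = 2 -> al != 0 -> is_root be ->
  exists c : int, pairing be t = c%:~R /\
    (0 <= c -> exists2 u, root_space (be - c%:~R *: al) u & u != 0).
Proof.
move=> Hc xa ya xy at2 al0 [be0 [z zb z0]].
have [p [z' [zb' z0' xz]]] := string_top Hc al0 xa zb z0.
have [m [+ mP]] := highest_weight_string Hc al0 xa ya xy zb' z0' xz.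
rewrite pairingD pairingMn at2 mulrAC divff ?pnatr_eq0 // mul1r => E.
have {}E : pairing be t = (m%:Z - p%:Z * 2)%:~R.
  by apply: (addIr (2 *+ p)); rewrite E rmorphB rmorphM /= -mulr_natl; ring.
exists (m%:Z - p%:Z * 2); split=> // c0.
have pm : (p <= m)%N by lia.
exists (iter (m - p) (brk y) z'); last by apply: mP; rewrite leq_subr.
have := root_space_iter (m - p) ya zb'; congr root_space.
rewrite -addrA; congr (_ + _); rewrite -!scaler_nat scalerN -scalerBl -scaleNr.
by congr (_ *: _); rewrite natrB // rmorphB rmorphM /=; ring.
Qed.

(** If the pairing is negative, exchange the roles of [x] and [y]: this replaces
    [al] by [- al] and [t] by [- t], and leaves [pairing be t *: al] unchanged. *)
Lemma refl_root al be x y t : cartan_subalgebra H ->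
  root_space al x -> root_space (- al) y -> brk x y = vsval t ->
  pairing al t = 2 -> al != 0 -> is_root be ->
  is_root (be - pairing be t *: al).
Proof.
move=> Hc xa ya xy at2 al0 beR; split.
  apply/negP; rewrite subr_eq0 => /eqP beE.
  have b0 : pairing be t = 0.
    apply: (addrI (pairing be t)); rewrite addr0 -mulr2n -mulr_natr.
    by rewrite {2}beE pairingZ at2.
  by case: beR => /eqP; rewrite beE b0 scale0r.
have [c [cE cP]] := refl_root_upper Hc xa ya xy at2 al0 beR.
have yx : brk y x = vsval (- t) by rewrite brkC xy linearN.
have na0 : - al != 0 by rewrite oppr_eq0.
have nat2 : pairing (- al) (- t) = 2 by rewrite pairingN pairingNr opprK.
have xa' : root_space (- - al) x by rewrite opprK.
have [d [dE dP]] := refl_root_upper Hc ya xa' yx nat2 na0 beR.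
have [c0|c0] := leP 0 c; first by rewrite cE; apply: cP.
have dc : d = - c.
  by apply/eqP; rewrite -(eqr_int K) -dE pairingNr cE rmorphN.
rewrite cE -[_ *: al]opprK -scalerN -scaleNr -rmorphN -dc; apply: dP; lia.
Qed.

(** Lowering a vector of weight [k al], [k >= 2], passes through [al], [0] and
    [- al], where it lands on the line of [y], and so stops there; but the
    highest weight [2 (k + p)] of the string forces at least one more step. *)
Lemma root_mult_not_root al x y t k : cartan_subalgebra H ->
  root_space al x -> root_space (- al) y -> brk x y = vsval t ->
  pairing al t = 2 -> al != 0 -> (2 <= k)%N -> ~ is_root (al *+ k).
Proof.
move=> Hc xa ya xy at2 al0 k2 [_ [z zb z0]].
have [p [z' [zb' z0' xz]]] := string_top Hc al0 xa zb z0.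
have [m [+ mP]] := highest_weight_string Hc al0 xa ya xy zb' z0' xz.
rewrite -mulrnDr pairingMn at2 mulrAC divff ?pnatr_eq0 // mul1r -mulrnA.
move/eqP; rewrite eqr_nat => /eqP mE.
have u0 : root_space (0 : dual H) (iter (k + p) (brk y) z').
  have := root_space_iter (k + p) ya zb'.
  by rewrite -mulrnDr mulNrn subrr.
have uH := root_space0 Hc u0.
have : iter (k + p).+2 (brk y) z' != 0 by apply: mP; lia.
rewrite !iterS brkC; set u := iter _ _ _ in uH *.
have -> : brk y u = - (pairing (- al) (Subvs uH) *: y).
  by rewrite brkC -(ya (Subvs uH)).
by rewrite brkNl brkZl brkxx scaler0 !oppr0 eqxx.
Qed.

End Strings.

(** * The Killing form and the existence of coroots *)

Section Killing.
Context (K : numFieldType) (g : liealg K).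
Context (e : (\dim {:g}).-tuple g).
Hypothesis eP : basis_of fullv e.
Implicit Types x y z : g.

Definition admx x : 'M[K]_(\dim {:g}) := mxof e e (linfun (@brk K g x)).

Definition killing x y : K := \tr (admx x *m admx y).

Lemma admx_comb c x y : admx (c *: x + y) = c *: admx x + admx y.
Proof.
rewrite /admx -linearP; congr (mxof e e _); apply/lfunP => z.
by rewrite add_lfunE scale_lfunE !lfunE /= brk_linearl.
Qed.

(** Matrices act on row vectors, which reverses the order of compositions. *)
Lemma admx_brk x y : admx (brk x y) = admx y *m admx x - admx x *m admx y.
Proof.
rewrite /admx -!(mxof_comp _ _ eP) -raddfB; congr (mxof e e _); apply/lfunP => z.
by rewrite add_lfunE opp_lfunE !comp_lfunE !lfunE /= (brk_deriv x) addrK.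
Qed.

Lemma killingC x y : killing x y = killing y x.
Proof. exact: mxtrace_mulC. Qed.

Fact killing_is_scalar x : scalar (killing x).
Proof.
move=> c y z; rewrite ![killing x _]killingC.
by rewrite /killing admx_comb mulmxDl -scalemxAl linearP.
Qed.
HB.instance Definition _ x :=
  GRing.isLinear.Build K g K _ (killing x) (killing_is_scalar x).

Lemma killing_inv x y z : killing (brk x y) z = killing x (brk y z).
Proof.
rewrite /killing !admx_brk mulmxBl mulmxBr !raddfB /= !mulmxA; congr (_ - _).
by rewrite -[in LHS]mulmxA [LHS]mxtrace_mulC.
Qed.

Definition killing_row x : 'rV[K]_(\dim {:g}) := \row_j killing x e`_j.

Fact killing_row_linear : linear killing_row.
Proof. by move=> c x y; apply/rowP => j; rewrite !mxE !(killingC _ e`_j) linearP. Qed.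
HB.instance Definition _ :=
  GRing.isLinear.Build K g 'rV[K]_(\dim {:g}) _ killing_row killing_row_linear.

Definition killing_radical : {vspace g} := lker (linfun killing_row).

Lemma killing_radicalP x :
  reflect (forall y, killing x y = 0) (x \in killing_radical).
Proof.
rewrite memv_ker lfunE /=; apply: (iffP eqP) => [x0 y|x0]; last first.
  by apply/rowP => j; rewrite !mxE.
rewrite (coord_basis eP (memvf y)) linear_sum big1 // => j _.
rewrite linearZ /=; have /rowP/(_ j) := x0.
by rewrite !mxE => ->; rewrite mulr0.
Qed.

Lemma killing_radical_ideal : lie_ideal killing_radical.
Proof.
move=> x u /killing_radicalP uR; apply/killing_radicalP => y.
by rewrite brkC killingC linearN /= -killingC killing_inv uR oppr0.
Qed.

End Killing.

Section Coroots.
Context (K : numFieldType) (g : liealg K) (H : {vspace g}).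
Context (r : nat) (a : 'I_r -> dual H).
Hypothesis simple_g : lie_simple g.
Hypothesis cartanH : cartan_subalgebra H.
Hypothesis simple_a : simple_roots a.
Implicit Types (al be : dual H) (h : subvs_of H).

Lemma killing_weight (e : (\dim {:g}).-tuple g) (wt : 'I_(\dim {:g}) -> dual H) h h' :
  basis_of fullv e -> (forall j, root_space (wt j) e`_j) ->
  killing e (vsval h) (vsval h') = \sum_j pairing (wt j) h * pairing (wt j) h'.
Proof.
move=> eP wtP.
have D t : admx e (vsval t) = diag_mx (\row_j pairing (wt j) t).
  apply/matrixP => i j; rewrite !mxE /= vecof_delta lfunE /= wtP linearZ /=.
  by rewrite coord_free ?(basis_free eP) // mulr_natr.
rewrite /killing !D mulmx_diag mxtrace_diag.
by apply: eq_bigr => j _; rewrite !mxE.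
Qed.

(** The fundamental coweights add up to an element on which every root takes
    its height as value. *)
Lemma height_element : exists h : subvs_of H, forall i, pairing (a i) h = 1.
Proof.
have [aP _ _] := simple_a.
pose A := \matrix_(i < r, k < \dim H) pairing (a i) (vsproj H (vbasis H)`_k).
have /row_freeP[B AB] : row_free A.
  (* [A] is the matrix of the simple roots on a basis of [H]. *)
  apply: inj_row_free => v vA.
  have v0 : \sum_i v 0 i *: [tuple a i | i < r]`_i = 0.
    apply: pairing_inj => h; rewrite pairing0 pairing_sum.
    have -> : h = \sum_k coord (vbasis H) k (vsval h) *: vsproj H (vbasis H)`_k.
      apply/val_inj; rewrite /= linear_sum /= {1}(coord_vbasis (subvsP h)).
      by apply: eq_bigr => k _; rewrite vsprojK ?vbasis_mem ?memt_nth.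
    under eq_bigr => i _ do rewrite pairingZ pairing_sumr mulr_sumr.
    rewrite exchange_big big1 //= => k _.
    have /rowP/(_ k) := vA; rewrite !mxE => vAk.
    transitivity (coord (vbasis H) k (vsval h) * \sum_j v 0 j * A j k).
      rewrite mulr_sumr; apply: eq_bigr => i _.
      by rewrite pairingZr mxE -(tnth_nth 0 [tuple a i | i < r]) tnth_mktuple mulrCA.
    by rewrite vAk mulr0.
  have /freeP fr := basis_free aP; apply/rowP => i; rewrite mxE.
  exact: (fr (v 0) v0).
exists (\sum_k (B *m (const_mx 1 : 'cV_r)) k 0 *: vsproj H (vbasis H)`_k) => i.
rewrite pairing_sumr; under eq_bigr do rewrite pairingZr.
have /matrixP/(_ i 0) : A *m (B *m (const_mx 1 : 'cV_r)) = const_mx 1.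
  by rewrite mulmxA AB mul1mx.
rewrite mxE [RHS]mxE => E; rewrite -[RHS]E; apply: eq_bigr => k _.
by rewrite [A _ _]mxE mulrC.
Qed.

(** The square makes the value independent of the sign of the root. *)
Lemma root_height : exists h : subvs_of H, forall al : dual H, is_root al ->
  exists2 m : nat, (0 < m)%N & pairing al h ^+ 2 = m%:R.
Proof.
have [h hP] := height_element; exists h => al alR.
have [_ _ /(_ _ alR)[c cP]] := simple_a.
have sE : pairing (\sum_i a i *+ c i) h = (\sum_i c i)%:R.
  by rewrite pairing_sum natr_sum; apply: eq_bigr => i _; rewrite pairingMn hP.
exists ((\sum_i c i) ^ 2)%N; last first.
  by rewrite natrX; case: cP => ->; rewrite ?pairingN ?sqrrN sE.
rewrite expn_gt0 orbF lt0n; apply/negP; rewrite sum_nat_eq0 => /forallP c0.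
have s0 : \sum_i a i *+ c i = 0.
  by apply: big1 => i _; move: (c0 i) => /= /eqP ->.
by case: alR => /eqP; case: cP => ->; rewrite s0 ?oppr0.
Qed.

(** Otherwise the radical, an ideal, is everything. At an element [h] on
    which the roots have positive integral squares, the form is the sum of the
    squares of the weights [wt j h]; so all weights are zero, and [g = H] is
    abelian. *)
Lemma killing_nondegenerate (e : (\dim {:g}).-tuple g) (wt : 'I_(\dim {:g}) -> dual H) :
  basis_of fullv e -> (forall j, root_space (wt j) e`_j) ->
  killing_radical e = 0%VS.
Proof.
move=> eP wtP; have [[x0 [y0 xy0]] gs] := simple_g.
have [//|Rf] := gs _ (killing_radical_ideal eP).
have K0 x y : killing e x y = 0.
  by apply: (killing_radicalP eP); rewrite Rf memvf.
have [h hP] := root_height.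
have e0 (j : 'I_(\dim {:g})) : e`_j != 0.
  by apply: (basis_not0 eP); rewrite mem_nth ?size_tuple ?ltn_ord.
have wt2 j : wt j != 0 -> exists2 m : nat, (0 < m)%N & pairing (wt j) h ^+ 2 = m%:R.
  by move=> w0; apply: hP; split=> //; exists e`_j.
have wt0 j : wt j = 0.
  apply: contrapT => /eqP w0; have [m m0 mE] := wt2 j w0.
  have := K0 (vsval h) (vsval h); rewrite (killing_weight _ _ eP wtP).
  under eq_bigr do rewrite -expr2.
  move/eqP; rewrite psumr_eq0 => [/allP/(_ j)|i _].
    by rewrite mem_index_enum mE pnatr_eq0 => /(_ isT)/eqP m0'; rewrite m0' in m0.
  have [->|/wt2[m' _ ->]] := eqVneq (wt i) 0; last exact: ler0n.
  by rewrite pairing0 expr0n.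
have allH x : x \in H.
  rewrite (coord_basis eP (memvf x)); apply: rpred_sum => j _; apply: rpredZ.
  by apply: root_space0 => //; rewrite -(wt0 j).
by case/eqP: xy0; case: cartanH => HC _ _; apply: HC.
Qed.

(** Some basis vector [y] is not orthogonal to a root vector [x]; invariance of
    the form forces its weight to be [- al], and gives
    [killing h t = al h * killing x y] for [t = brk x y]. If [al t = 0], then [t]
    is killed by all weights and hence orthogonal to [H], and [al = 0]. *)
Lemma coroot_exists al : is_root al -> exists h, is_coroot al h.
Proof.
move=> [al0 [x xa x0]].
have [e [wt [eP wtP]]] := weight_basis cartanH.
have e0 (j : 'I_(\dim {:g})) : e`_j != 0.
  by apply: (basis_not0 eP); rewrite mem_nth ?size_tuple ?ltn_ord.
have [j kj] : exists j : 'I_(\dim {:g}), killing e x e`_j != 0.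
  apply/existsP; apply: contraNT x0; rewrite negb_exists => /forallP k0.
  rewrite -memv0 -(killing_nondegenerate eP wtP) memv_ker lfunE /=.
  by apply/eqP/rowP => i; rewrite !mxE; apply/eqP/negPn.
have wtj : wt j = - al.
  apply: pairing_inj => h; apply/eqP; rewrite pairingN -addr_eq0; apply/eqP.
  apply: (mulIf kj); rewrite mul0r.
  have := killing_inv eP x (vsval h) e`_j; rewrite wtP linearZ /=.
  rewrite brkC xa killingC linearN linearZ /= -killingC => E.
  by rewrite mulrDl -E addrC subrr.
have ya : root_space (- al) e`_j by rewrite -wtj.
have tH : brk x e`_j \in H.
  by apply: root_space0 => //; rewrite -(subrr al); apply: root_space_brk.
pose t := Subvs tH.
have at0 : pairing al t != 0.
  apply/negP => /eqP at0; case/eqP: (al0); apply: pairing_inj => h.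
  rewrite pairing0; apply: (mulIf kj); rewrite mul0r.
  have : killing e (vsval h) (vsval t) = 0.
    rewrite (killing_weight _ _ eP wtP) big1 // => i _.
    rewrite (heisenberg_weight0 cartanH _ xa ya (t := t) _ at0 (wtP i)) ?mulr0 //.
  by rewrite -killing_inv // xa killingC linearZ /= killingC.
pose c := 2 / pairing al t.
exists (c *: t); split; first by rewrite pairingZr divfK.
exists x, (c *: e`_j); split=> //; first exact: root_spaceZ.
by rewrite linearZ /= [RHS]linearZ.
Qed.

End Coroots.

(** * Simple reflections and positive roots *)

Section RootSystem.
Context (K : numFieldType) (g : liealg K) (H : {vspace g}).
Context (r : nat) (a : 'I_r -> dual H).
Hypothesis simple_g : lie_simple g.
Hypothesis cartanH : cartan_subalgebra H.
Hypothesis simple_a : simple_roots a.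
Implicit Types (al be v : dual H) (i j k : 'I_r) (w u : seq 'I_r).
Local Notation s i := (reflection (a i)).
Local Notation co i := (coroot (a i)).
Local Notation wp := (word_prod a).

Lemma corootP al : is_root al -> is_coroot al (coroot al).
Proof.
by move=> /(coroot_exists simple_g cartanH simple_a)[h hP]; apply: xgetPex; exists h.
Qed.

Lemma root_sub_pairing al be : is_root al -> is_root be ->
  is_root (be - pairing be (coroot al) *: al).
Proof.
move=> alR beR; have [al2 [x [y [xa ya E]]]] := corootP alR.
exact: (refl_root cartanH xa ya (esym E) al2 (is_root_neq0 alR) beR).
Qed.

Lemma root_mulrn al (m : nat) : is_root al -> is_root (al *+ m) -> (m <= 1)%N.
Proof.
move=> alR kR; have [al2 [x [y [xa ya E]]]] := corootP alR; rewrite leqNgt.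
by apply/negP => /(root_mult_not_root cartanH xa ya (esym E) al2 (is_root_neq0 alR)).
Qed.

Lemma roots_finite : exists l : seq (dual H), forall al, is_root al -> al \in l.
Proof.
have [l lP] := root_space_finite cartanH; exists l => al [_ [x xa x0]].
exact: lP xa x0.
Qed.

Lemma reflE al v : reflection al v = v - pairing v (coroot al) *: al.
Proof.
pose f (u : dual H) : dual H := u - pairing u (coroot al) *: al.
have fl : linear f.
  move=> c u u'; rewrite /f pairingD pairingZ scalerDl -scalerA opprD.
  by rewrite scalerBr addrACA.
pose fL := GRing.isLinear.Build _ _ _ _ f fl.
pose ff : {linear dual H -> dual H} := HB.pack f fL.
by rewrite /reflection -[LHS]/(linfun ff v) lfunE.
Qed.

Lemma simple_is_root i : is_root (a i). Proof. by case: simple_a. Qed.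

Lemma pairing_simple i : pairing (a i) (co i) = 2.
Proof. by case: (corootP (simple_is_root i)). Qed.

Lemma refl_simple i : s i (a i) = - a i.
Proof.
by rewrite reflE pairing_simple scaler_nat mulr2n opprD addrA subrr sub0r.
Qed.

Lemma reflK i v : s i (s i v) = v.
Proof.
rewrite [s i v]reflE linearB linearZ /= refl_simple scalerN opprK reflE.
by rewrite subrK.
Qed.

Lemma root_opp al : is_root al -> is_root (- al).
Proof.
move=> alR; have := root_sub_pairing alR alR; have [-> _] := corootP alR.
by rewrite scaler_nat mulr2n opprD addrA subrr sub0r.
Qed.

Lemma refl_is_root i al : is_root al -> is_root (s i al).
Proof. by move=> alR; rewrite reflE; apply: root_sub_pairing => //; apply: simple_is_root. Qed.

Definition scoord i v : K := coord [tuple a i | i < r] i v.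

Fact scoord_is_scalar i : scalar (scoord i).
Proof. by move=> c u v; rewrite /scoord linearP. Qed.
HB.instance Definition _ i :=
  GRing.isLinear.Build K (dual H) K _ (scoord i) (scoord_is_scalar i).

Lemma simple_free : free [tuple a i | i < r].
Proof. by case: simple_a => /basis_free. Qed.

Lemma scoord_simple i j : scoord i (a j) = (j == i)%:R.
Proof.
by rewrite /scoord -(coord_free j i simple_free) -(tnth_nth 0 [tuple a i | i < r]) tnth_mktuple.
Qed.

Lemma scoord_eq v v' : (forall i, scoord i v = scoord i v') -> v = v'.
Proof.
have [/coord_basis bP _ _] := simple_a.
move=> E; rewrite (bP v) ?memvf // (bP v') ?memvf //.
by apply: eq_bigr => i _; rewrite -[coord _ _ _]/(scoord i v) E.
Qed.

Lemma scoord_sum i (c : 'I_r -> nat) : scoord i (\sum_j a j *+ c j) = (c i)%:R.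
Proof.
rewrite linear_sum (bigD1 i) //= raddfMn /= scoord_simple eqxx big1 ?addr0 //.
by move=> j /negbTE ji; rewrite raddfMn /= scoord_simple ji mul0rn.
Qed.

Lemma scoord_refl i j v : i != j -> scoord i (s j v) = scoord i v.
Proof.
move=> ij; rewrite reflE linearB linearZ /= scoord_simple.
by rewrite eq_sym (negbTE ij) mulr0 subr0.
Qed.

Definition nat_comb v := exists c : 'I_r -> nat, v = \sum_i a i *+ c i.

Lemma nat_combP v : nat_comb v <-> forall i, exists n : nat, scoord i v = n%:R.
Proof.
split=> [[c ->] i|/fin_all_exists[c cE]]; first by exists (c i); rewrite scoord_sum.
by exists c; apply: scoord_eq => i; rewrite scoord_sum.
Qed.

Lemma nat_comb_opp v : nat_comb v -> nat_comb (- v) -> v = 0.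
Proof.
move=> [c cE] [d dE]; apply: scoord_eq => i; rewrite linear0.
have : scoord i v + scoord i (- v) = 0 by rewrite -linearD subrr linear0.
rewrite dE {1}cE !scoord_sum -natrD => /eqP; rewrite pnatr_eq0 addn_eq0.
by case/andP => /eqP c0 _; rewrite cE scoord_sum c0.
Qed.

Lemma root_sign al : is_root al -> nat_comb al \/ nat_comb (- al).
Proof.
case: simple_a => _ _ sP /sP[c [->|->]]; first by left; exists c.
by right; exists c; rewrite opprK.
Qed.

Lemma positive_root_opp al : positive_root a al -> ~ positive_root a (- al).
Proof. by move=> [[/eqP al0 _] ap] [_ an]; apply: al0; apply: nat_comb_opp. Qed.

Lemma positive_simple i : positive_root a (a i).
Proof.
split; first exact: simple_is_root.
by apply/nat_combP => j; exists (i == j :> nat); rewrite scoord_simple.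
Qed.

(** A positive root other than [a i] is not a multiple of [a i], so another
    simple root occurs in it; its coefficient survives in the reflected root,
    which is therefore not negative. *)
Lemma refl_positive i al : positive_root a al -> al <> a i ->
  positive_root a (s i al).
Proof.
move=> [alR [c cE]] alN.
have [j /andP[ij cj]] : exists j, (j != i) && (c j != 0)%N.
  apply: contrapT => no; apply: alN.
  have c0 j : j != i -> c j = 0%N.
    by move=> ji; apply/eqP/negPn/negP => cj; apply: no; exists j; rewrite ji.
  have alE : al = a i *+ c i.
    rewrite cE (bigD1 i) //= big1 ?addr0 // => j /c0 ->; exact: mulr0n.
  have := root_mulrn (m := c i) (simple_is_root i); rewrite -alE => /(_ alR).
  case ci: (c i) => [|[|//]] _; last by rewrite alE ci.
  by case: alR => /eqP; rewrite alE ci.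
have sR := refl_is_root i alR; split=> //.
case: (root_sign sR) => // -[d dE]; case/eqP: cj; apply/eqP.
have := congr1 (scoord j) dE; rewrite linearN /= scoord_refl // cE !scoord_sum.
move/eqP; rewrite eq_sym -addr_eq0 -natrD pnatr_eq0 addn_eq0.
by case/andP.
Qed.

Lemma in_positive_roots al : (al \in positive_roots a) <-> positive_root a al.
Proof.
have [l lP] := roots_finite.
have fin : finite_set (positive_root a).
  apply: (@sub_finite_set _ _ [set` l]); last exact: finite_seq.
  by move=> be [/lP].
by rewrite /positive_roots in_fset_set // inE.
Qed.

(** The reflection [s i] permutes the positive roots other than [a i], and it
    negates [a i]; so it maps the sum of the positive roots, [2 rho], to
    [2 rho - 2 a i]. *)
Lemma pairing_rho i : pairing (rho a) (co i) = 1.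
Proof.
pose P := [seq al <- positive_roots a | al != a i].
have inP al : (al \in P) <-> positive_root a al /\ al <> a i.
  rewrite mem_filter; split=> [/andP[/eqP ai /in_positive_roots]|[ap ai]] //.
  by apply/andP; split; [apply/eqP|apply/in_positive_roots].
have Pu : uniq P by rewrite filter_uniq ?fset_uniq.
have s_inj : injective (s i) by apply: can_inj (reflK i).
have PP : perm_eq [seq s i al | al <- P] P.
  have Ps : uniq [seq s i al | al <- P] by rewrite map_inj_uniq.
  have sP : {subset [seq s i al | al <- P] <= P}.
    move=> _ /mapP[al /inP[ap ai] ->]; apply/inP; split; first exact: refl_positive.
    move=> /(congr1 (s i)); rewrite reflK refl_simple => alE.
    by apply: (positive_root_opp (positive_simple i)); rewrite -alE.
  by apply: uniq_perm => //; apply: (uniq_min_size Ps sP _).2; rewrite size_map.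
have sumE : \sum_(al <- positive_roots a) al = a i + \sum_(al <- P) al.
  rewrite big_filter (bigD1_seq (a i)) ?fset_uniq //.
  by apply/in_positive_roots; apply: positive_simple.
have : s i (rho a) = rho a - a i.
  rewrite /rho linearZ /= sumE linearD /= refl_simple linear_sum /=.
  rewrite -(big_map (s i) xpredT idfun) /= (perm_big _ PP) /=.
  rewrite -[X in _ = _ - X](scale1r (a i)) -[X in X *: a i](mulVf (_ : 2 != 0 :> K)) ?pnatr_eq0 //.
  rewrite -scalerA -scalerBr scaler_nat mulr2n; congr (_ *: _).
  by rewrite opprD addrACA subrr add0r addrC.
rewrite reflE => /addrI /oppr_inj /(congr1 (scoord i)).
by rewrite linearZ /= scoord_simple eqxx mulr1.
Qed.

(** * Words in the simple reflections *)

Lemma wp_nil v : wp [::] v = v.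
Proof. by rewrite /word_prod big_nil id_lfunE. Qed.

Lemma wp_cons i w v : wp (i :: w) v = s i (wp w v).
Proof. by rewrite /word_prod big_cons comp_lfunE. Qed.

Lemma wp_cat u w v : wp (u ++ w) v = wp u (wp w v).
Proof. by elim: u => [|i u IH] /=; rewrite ?wp_nil // !wp_cons IH. Qed.

Lemma wp_rcons w i v : wp (rcons w i) v = wp w (s i v).
Proof. by rewrite -cats1 wp_cat wp_cons wp_nil. Qed.

Lemma wp_revK w v : wp (rev w) (wp w v) = v.
Proof.
elim: w v => [|i w IH] v; first by rewrite !wp_nil.
by rewrite rev_cons wp_rcons wp_cons reflK IH.
Qed.

Lemma wp_is_root w al : is_root al -> is_root (wp w al).
Proof.
elim: w => [|i w IH] alR; first by rewrite wp_nil.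
by rewrite wp_cons; apply: refl_is_root => //; apply: IH.
Qed.

Lemma wp_fixed w v : (forall i, i \in w -> s i v = v) -> wp w v = v.
Proof.
elim: w => [|i w IH] fw; first by rewrite wp_nil.
rewrite wp_cons IH ?fw ?mem_head // => j jw; apply: fw.
by rewrite in_cons jw orbT.
Qed.

Lemma scoord_wp w k v : k \notin w -> scoord k (wp w v) = scoord k v.
Proof.
elim: w => [|i w IH]; first by rewrite wp_nil.
by rewrite in_cons negb_or => /andP[ki /IH IHw]; rewrite wp_cons scoord_refl.
Qed.

(** Let [w'] invert [w]. The map [w' s_j w s_i] permutes the roots and has the
    form [v |-> v + f v a_i] with [f a_i = 0]. Its iterates add multiples of
    [f v a_i] to [v], so that [f] vanishes on the finite set of roots, which
    spans. *)
Lemma wp_conj_refl w i j v : wp w (a i) = a j -> wp w (s i v) = s j (wp w v).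
Proof.
move=> wij; pose f x := pairing x (co i) - pairing (wp w x) (co j).
have fD c x y : f (c *: x + y) = c * f x + f y.
  by rewrite /f linearD linearZ /= !pairingD !pairingZ; ring.
have fi : f (a i) = 0 by rewrite /f wij !pairing_simple subrr.
have step x : wp (rev w) (s j (wp w (s i x))) = x + f x *: a i.
  rewrite [s i x]reflE linearB linearZ /= wij linearB linearZ /= refl_simple.
  rewrite reflE scalerN opprK -addrA -scaleNr -scalerDl addrC.
  rewrite linearD linearZ /= wp_revK -[in X in _ *: X]wij wp_revK [LHS]addrC.
  by rewrite [- _ + _]addrC.
have f_root al : is_root al -> f al = 0.
  move=> alR; have [l lP] := roots_finite.
  suff /eqP : f al *: a i = 0.
    rewrite scaler_eq0 => /orP[/eqP //|/eqP a0].
    by case: (simple_is_root i); rewrite a0 eqxx.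
  apply: (@arith_progression_finite _ _ l al) => m; apply: lP.
  suff [] : is_root (al + f al *: a i *+ m) /\ f (al + f al *: a i *+ m) = f al by [].
  elim: m => [|m [IHR IHf]]; first by rewrite addr0.
  have -> : al + f al *: a i *+ m.+1 = al + f al *: a i *+ m + f al *: a i.
    by rewrite mulrSr addrA.
  split; last by rewrite addrC fD fi mulr0 add0r.
  rewrite -{2}IHf -step; apply: wp_is_root; apply: refl_is_root.
  by apply: wp_is_root; apply: refl_is_root.
have f0 : f v = 0.
  have [/coord_basis bP _ _] := simple_a; rewrite (bP v) ?memvf //.
  elim/big_rec: _ => [|k x _ IH].
    by rewrite /f linear0 !pairing0 subrr.
  rewrite fD IH -(tnth_nth 0 [tuple a i | i < r]) tnth_mktuple f_root ?mulr0 ?addr0 //.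
  exact: simple_is_root.
by have := step v; rewrite f0 scale0r addr0 => {2}<-; rewrite -{2}[w]revK wp_revK reflK.
Qed.

Definition reduced w := forall w', wp w' = wp w -> (size w <= size w')%N.

(** Reading the word from the right, [a i] turns negative at some letter [j];
    just before, it was [a j] itself, the only positive root negated by [s j],
    and this letter can be struck out. *)
Lemma exchange w i : positive_root a (- wp w (a i)) ->
  exists w', size w = (size w').+1 /\ forall v, wp w' v = wp w (s i v).
Proof.
elim: w => [|j w IH].
  by rewrite wp_nil => /(positive_root_opp (positive_simple i)).
rewrite wp_cons => jn; have wR := wp_is_root w (simple_is_root i).
have [wp_pos|wn] := root_sign wR; last first.
  have [|w' [ws wE]] := IH.
    by split=> //; apply: root_opp.
  exists (j :: w'); split=> /=; first by rewrite ws.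
  by move=> v; rewrite !wp_cons wE.
have wij : wp w (a i) = a j.
  apply: contrapT => wN; have := refl_positive (conj wR wp_pos) wN.
  by move/(positive_root_opp).
exists w; split=> // v.
by rewrite wp_cons (wp_conj_refl _ wij) reflK.
Qed.

Lemma reduced_rcons w i : reduced (rcons w i) -> reduced w.
Proof.
move=> wr w' wE; have := wr (rcons w' i); rewrite !size_rcons ltnS; apply.
by apply/lfunP => v; rewrite !wp_rcons wE.
Qed.

(** Were it negative, a letter of [w] could be struck out at the price of
    multiplying by [s i], which undoes the last letter: two letters saved. *)
Lemma reduced_positive w i : reduced (rcons w i) -> positive_root a (wp w (a i)).
Proof.
move=> wr; have wR := wp_is_root w (simple_is_root i).
split=> //; case: (root_sign wR) => // wn.
have [w' [ws wE]] : exists w', size w = (size w').+1 /\ forall v, wp w' v = wp w (s i v).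
  by apply: exchange; split=> //; apply: root_opp.
have := wr w'; rewrite size_rcons ws => /(_ _)/wrap[]; last by rewrite ltnNge leqnSn.
by apply/lfunP => v; rewrite wp_rcons.
Qed.

Lemma reduced_exists t : weyl_group a t -> exists w, reduced_word a t w.
Proof.
move=> [w0 w0E].
have ex : exists n, `[< exists2 w, wp w = t & size w = n >].
  by exists (size w0); apply/asboolP; exists w0.
case: (ex_minnP ex) => n /asboolP[w wE wn] nmin; exists w; split=> // w' w'E.
by rewrite wn; apply: nmin; apply/asboolP; exists w'.
Qed.

(** * The descent of a dominant regular weight *)

Section Descent.
Context (la mu : dual H).
Hypothesis dom_la : dominant_integral a la.
Local Notation lr := (la + rho a).

Lemma dominant_regular i : exists n : nat, pairing lr (co i) = n.+1%:R.
Proof.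
case: dom_la => _ /(_ i)[n nE]; exists n.
by rewrite pairingD nE pairing_rho natr1.
Qed.

(** These coordinates decide everything: their support is the influence of [t],
    they determine [t], and [t] is in the alternation set iff the coordinates of
    [la - mu] exceed them by natural numbers. *)
Definition descent t i : K := scoord i (lr - t lr).

(** Appending a letter [i] to a reduced word [w] adds to [lr - wp w lr] a
    positive multiple of the positive root [wp w (a i)]. The first time that
    [i] is read, this root involves [a i] with coefficient one. *)
Lemma reduced_descent w : reduced w ->
  exists c : 'I_r -> nat, (forall i, descent (wp w) i = (c i)%:R) /\
    forall i, (0 < c i)%N = (i \in w).
Proof.
elim/last_ind: w => [|w j IH] wr.
  exists (fun=> 0%N); split=> // i.
  by rewrite /descent wp_nil subrr linear0.
have [c [cE c0]] := IH (reduced_rcons wr).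
have [_ [d dE]] := reduced_positive wr.
have [n nE] := dominant_regular j.
exists (fun i => (c i + n.+1 * d i)%N); split=> i.
  rewrite /descent; have -> : lr - wp (rcons w j) lr = lr - wp w lr + n.+1%:R *: wp w (a j).
    rewrite wp_rcons [s j _]reflE nE linearB /= linearZ /=.
    by rewrite opprB addrCA addrC.
  rewrite linearD /= -/(descent (wp w) i) cE linearZ /= dE scoord_sum.
  by rewrite natrD natrM.
rewrite mem_rcons in_cons addn_gt0 c0 muln_gt0 /= orbC.
case iw: (i \in w); first by rewrite !orbT.
have : (d i)%:R = (j == i)%:R :> K.
  by rewrite -scoord_sum -dE scoord_wp ?iw // scoord_simple.
by move/eqP; rewrite eqr_nat => /eqP ->; rewrite orbF eq_sym; case: (i == j).
Qed.

Lemma descentP t : weyl_group a t ->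
  exists c : 'I_r -> nat, (forall i, descent t i = (c i)%:R) /\
    forall i, influence a t i <-> (0 < c i)%N.
Proof.
move=> /reduced_exists[w [wE wmin]].
have red w' : reduced_word a t w' -> reduced w'.
  by move=> [<- w'min].
have [c [cE c0]] := reduced_descent (red w (conj wE wmin)).
rewrite wE in cE; exists c; split=> // i.
split; last by rewrite c0 => iw; exists w.
case=> w' [w'E w'min] iw'.
have [c' [c'E c'0]] := reduced_descent (red w' (conj w'E w'min)).
by rewrite w'E in c'E; move: iw'; rewrite -c'0 -!(ltr0n K) -c'E cE.
Qed.

Lemma influence_descent t i : weyl_group a t ->
  influence a t i <-> descent t i != 0.
Proof.
by move=> /descentP[c [-> ->]]; rewrite pnatr_eq0 lt0n.
Qed.

(** This holds for all words, reduced or not. *)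
Lemma influence_sub_word w i : influence a (wp w) i -> i \in w.
Proof.
have wW : weyl_group a (wp w) by exists w.
move/(influence_descent i wW); apply: contraNT => iw.
by rewrite /descent linearB /= scoord_wp // subrr.
Qed.

Lemma weyl_influence0 t : weyl_group a t -> (forall i, ~ influence a t i) -> t = \1%VF.
Proof.
move=> /reduced_exists[w [<- wmin]] no.
case: w wmin no => [|i w] wmin no; first by rewrite /word_prod big_nil.
by case: (no i); exists (i :: w); rewrite ?mem_head.
Qed.

(** Equal descents mean [t lr = t' lr]; then the descent of [t'^-1 t] vanishes,
    so no letter occurs in its reduced words. *)
Lemma weyl_descent_inj t t' : weyl_group a t -> weyl_group a t' ->
  (forall i, descent t i = descent t' i) -> t = t'.
Proof.
move=> [w <-] [w' <-] E.
have {}E : wp w lr = wp w' lr.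
  apply: scoord_eq => i; have := E i; rewrite /descent !linearB /=.
  by move/addrI/oppr_inj.
have W : weyl_group a (wp (rev w' ++ w)) by exists (rev w' ++ w).
have /lfunP one : wp (rev w' ++ w) = \1%VF.
  apply: weyl_influence0 => // i /(influence_descent i W).
  by rewrite /descent wp_cat E wp_revK subrr linear0 eqxx.
apply/lfunP => v; have := one v; rewrite id_lfunE wp_cat => vE.
by rewrite -[in RHS]vE -{1}[w']revK wp_revK.
Qed.


(** * Independent elements *)

Lemma adjacentC i j : adjacent a i j = adjacent a j i.
Proof. by rewrite /adjacent eq_sym mulrC. Qed.

(** If [s i] fixes [a j], then [s i] and [s j] commute; comparing their two
    products at [a i] gives the other Cartan integer. *)
Lemma cartan_zero_sym i j : pairing (a j) (co i) = 0 -> pairing (a i) (co j) = 0.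
Proof.
move=> ji0; have sij : wp [:: i] (a j) = a j.
  by rewrite wp_cons wp_nil reflE ji0 scale0r subr0.
have := wp_conj_refl (a i) sij; rewrite !wp_cons !wp_nil refl_simple linearN /=.
rewrite [s j (a i)]reflE linearB linearZ /= refl_simple.
rewrite [s i (a j)]reflE ji0 scale0r subr0 opprB => /(congr1 (scoord j)).
rewrite !linearB !linearN !linearZ /= (scoord_simple j j) eqxx mulr1 addrC => /addIr /eqP.
by rewrite eqNr => /eqP.
Qed.

Lemma nonadjacent_fix i j : i != j -> ~~ adjacent a i j -> s i (a j) = a j.
Proof.
rewrite /adjacent => -> /=; rewrite negbK mulf_eq0 => ij0; rewrite reflE.
suff -> : pairing (a j) (co i) = 0 by rewrite scale0r subr0.
by case/orP: ij0 => /eqP // /cartan_zero_sym.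
Qed.

Lemma nonadjacent_comm i j v : i != j -> ~~ adjacent a i j ->
  s i (s j v) = s j (s i v).
Proof.
move=> ij nij; have := @wp_conj_refl [:: i] j j v.
by rewrite !wp_cons !wp_nil; apply; apply: nonadjacent_fix.
Qed.

Lemma independentP t t' : independent a t t' <->
  forall i j, influence a t i -> influence a t' j -> i != j /\ ~~ adjacent a i j.
Proof.
split=> [E i j it jt'|E]; last first.
  apply/seteqP; split=> // i [it [it'|[j jt' ij]]].
    by have [] := E i i it it'; rewrite eqxx.
  by have [_] := E i j it jt'; rewrite ij.
split; apply/negP => ij.
  by move: E => /seteqP[/(_ i)+ _]; apply; split=> //; left; rewrite (eqP ij).
by move: E => /seteqP[/(_ i)+ _]; apply; split=> //; right; exists j.
Qed.

Lemma independentC t t' : independent a t t' -> independent a t' t.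
Proof.
move=> /independentP E; apply/independentP => i j it jt'.
by have [] := E j i jt' it; rewrite eq_sym adjacentC.
Qed.

Lemma weyl1 : weyl_group a \1%VF.
Proof. by exists [::]; rewrite /word_prod big_nil. Qed.

Lemma weyl_comp t t' : weyl_group a t -> weyl_group a t' -> weyl_group a (t \o t')%VF.
Proof.
move=> [w <-] [w' <-]; exists (w ++ w').
by apply/lfunP => v; rewrite comp_lfunE wp_cat.
Qed.

Lemma descent1 i : descent \1%VF i = 0.
Proof. by rewrite /descent id_lfunE subrr linear0. Qed.

(** [lr - t t' lr = (lr - t lr) + t (lr - t' lr)], and [t] fixes the simple
    roots occurring in [lr - t' lr], none being adjacent to a letter of [t]. *)
Lemma independent_descent t t' i : weyl_group a t -> weyl_group a t' ->
  independent a t t' -> descent (t \o t')%VF i = descent t i + descent t' i.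
Proof.
move=> tW t'W /independentP ind.
have t_fix : t (lr - t' lr) = lr - t' lr.
  have [c [cE c0]] := descentP t'W.
  have [w [wE wmin]] := reduced_exists tW.
  have -> : lr - t' lr = \sum_j a j *+ c j.
    by apply: scoord_eq => j; rewrite scoord_sum -cE.
  rewrite linear_sum; apply: eq_bigr => j _ /=; rewrite raddfMn /=.
  case cj: (c j) => [|n]; first by rewrite !mulr0n.
  rewrite -wE wp_fixed // => k kw.
  have [||kj nkj] := ind k j; last exact: nonadjacent_fix.
    by exists w.
  by apply/c0; rewrite cj.
rewrite /descent -linearD; congr (scoord i _); rewrite comp_lfunE.
by rewrite -t_fix linearB addrA subrK.
Qed.

Lemma descent_ge0 t i : weyl_group a t -> 0 <= descent t i.
Proof. by move=> /descentP[c [-> _]]; apply: ler0n. Qed.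

Definition comp_list (l : seq 'End(dual H)) : 'End(dual H) :=
  \big[(@comp_lfun K _ _ _) / \1%VF]_(t <- l) t.

Definition independent_list (l : seq 'End(dual H)) :=
  [/\ uniq l, forall t, t \in l -> weyl_group a t & pairwise_independent a [set` l]].

Lemma independent_list_behead t l :
  independent_list (t :: l) -> independent_list l.
Proof.
case=> /andP[_ lu] lW li; split=> // [t' t'l|t1 t2 l1 l2]; first by apply: lW; rewrite in_cons t'l orbT.
by apply: li; rewrite /= in_cons ?l1 ?l2 orbT.
Qed.

(** The influence of a product is the union of the influences of its factors, so
    a factor stays independent of the product of the others; hence the joint
    induction. *)
Lemma comp_list_descent l : independent_list l ->
  weyl_group a (comp_list l) /\
  forall i, descent (comp_list l) i = \sum_(t <- l) descent t i.
Proof.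
elim: l => [|t l IH] lP.
  rewrite /comp_list big_nil; split=> [|i]; first exact: weyl1.
  by rewrite descent1 big_nil.
have [lW lE] := IH (independent_list_behead lP).
have {lP}[/andP[tl _] ltW lti] := lP.
have tW : weyl_group a t by apply: ltW; rewrite mem_head.
rewrite /comp_list big_cons -/(comp_list l); split=> [|i]; first exact: weyl_comp.
rewrite big_cons -lE independent_descent //.
apply/independentP => j k jt /(influence_descent k lW); rewrite lE => lk.
have /hasP[t' t'l kt'] : has (fun t' : 'End(dual H) => descent t' k != 0) l.
  apply: contraNT lk => /hasPn no; rewrite big_seq big1 // => t' /no.
  by rewrite negbK => /eqP.
have t'tl : t' \in t :: l by rewrite in_cons t'l orbT.
have /independentP : independent a t t'.
  by apply: lti; rewrite /= ?mem_head // => tE; move: tl; rewrite tE t'l.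
by apply=> //; apply/influence_descent => //; apply: ltW.
Qed.

Lemma influence_comp_list l i : independent_list l ->
  influence a (comp_list l) i <-> exists2 t, t \in l & influence a t i.
Proof.
move=> lP; have [lW lE] := comp_list_descent lP; have [_ ltW _] := lP.
rewrite (influence_descent i lW) lE.
rewrite big_seq psumr_neq0; last by move=> t /ltW tW; apply: descent_ge0.
split=> [/hasP[t tl /andP[_ /lt0r_neq0 ti]]|[t tl ti]].
  by exists t => //; apply/influence_descent => //; apply: ltW.
apply/hasP; exists t => //; rewrite tl lt0r descent_ge0 ?andbT //; last exact: ltW.
by apply/influence_descent => //; apply: ltW.
Qed.

Lemma independent_common t t' i : influence a t i -> influence a t' i ->
  ~ independent a t t'.
Proof. by move=> ti t'i /independentP/(_ i i ti t'i)[]; rewrite eqxx. Qed.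

Lemma comp_list_descent_at l t i : independent_list l -> t \in l ->
  influence a t i -> descent (comp_list l) i = descent t i.
Proof.
move=> lP tl ti; have [_ ->] := comp_list_descent lP; have [lu ltW li] := lP.
rewrite (bigD1_seq t) //= big_seq_cond big1 ?addr0 // => t' /andP[t'l t't].
apply/eqP/negPn/negP => /(influence_descent i (ltW _ t'l)) t'i.
apply: (independent_common ti t'i); apply: li => //.
by apply/eqP; rewrite eq_sym.
Qed.

Lemma weyl_neq1 t : weyl_group a t -> t <> \1%VF -> exists i, influence a t i.
Proof.
move=> tW t1; apply: contrapT => no; apply: t1; apply: weyl_influence0 => // i ti.
by apply: no; exists i.
Qed.

(** * Decomposition along connected components *)

Definition connected_factor t :=
  [/\ weyl_group a t, t <> \1%VF & induces_connected a (influence a t)].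

Definition connected_factors l :=
  independent_list l /\ forall t, t \in l -> connected_factor t.

Lemma wp_comm i u v : (forall j x, j \in u -> s i (s j x) = s j (s i x)) ->
  s i (wp u v) = wp u (s i v).
Proof.
elim: u => [|j u IH] comm; first by rewrite !wp_nil.
rewrite !wp_cons comm ?mem_head // IH // => k x ku.
by apply: comm; rewrite in_cons ku orbT.
Qed.

(** Letters inside [C] commute with letters outside, so they can be moved to the
    front. *)
Lemma wp_filter (C : pred 'I_r) w v :
  (forall i j, i \in w -> j \in w -> C i -> ~~ C j -> ~~ adjacent a i j) ->
  wp w v = wp (filter C w) (wp (filter (predC C) w) v).
Proof.
elim: w => [|i w IH] sep /=; first by rewrite !wp_nil.
have {}IH : wp w v = wp (filter C w) (wp (filter (predC C) w) v).
  by apply: IH => j k jw kw; apply: sep; rewrite in_cons ?jw ?kw orbT.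
case: ifP => Ci /=; rewrite !wp_cons IH // wp_comm // => j x.
rewrite mem_filter => /andP[Cj jw]; apply: nonadjacent_comm.
  by apply: contraFneq Ci => ->.
by rewrite adjacentC; apply: sep; rewrite ?in_cons ?jw ?orbT ?eqxx // Ci.
Qed.

(** Let [C] be the connected component of the first letter of a reduced word of
    [t]. The letters in [C] form a first factor [b] and the other ones an element
    [t'] independent of [b] and shorter than [t]. That the influence of [b] is
    the whole of [C] follows from the descent of [t] being the sum of those of
    [b] and [t']. *)
Lemma connected_factorization t : weyl_group a t ->
  exists2 l, connected_factors l & comp_list l = t.
Proof.
move=> /reduced_exists[w].
have [n] := ubnP (size w); elim: n => // n IH in t w * => wn tw.
have tW : weyl_group a t by case: tw => <- _; exists w.
case: w => [|i0 w0] in wn tw *.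
  exists [::]; last by case: tw => <- _; rewrite /comp_list /word_prod !big_nil.
  by split=> //; split.
move: (i0 :: w0) (mem_head i0 w0) wn tw => w i0w wn tw {w0}.
have inw i : i \in w -> influence a t i by move=> iw; exists w.
have winf i : influence a t i -> i \in w by case: tw => <- _; apply: influence_sub_word.
set e := [rel k l | [&& k \in influence a t, l \in influence a t & adjacent a k l]].
pose C := [pred j | connect e i0 j].
have eP k l : k \in w -> l \in w -> adjacent a k l -> e k l.
  by move=> kw lw kl; apply/and3P; split=> //; rewrite in_setE; apply: inw.
have sep i j : i \in w -> j \in w -> C i -> ~~ C j -> ~~ adjacent a i j.
  move=> iw jw Ci; apply: contra => ij; apply: connect_trans Ci (connect1 _).
  exact: eP.
pose b := wp (filter C w); pose t' := wp (filter (predC C) w).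
have bW : weyl_group a b by exists (filter C w).
have t'W : weyl_group a t' by exists (filter (predC C) w).
have tE : t = (b \o t')%VF.
  by apply/lfunP => v; rewrite comp_lfunE -wp_filter //; case: tw => ->.
have bC i : influence a b i -> i \in w /\ C i.
  by move=> /influence_sub_word; rewrite mem_filter => /andP[].
have t'C i : influence a t' i -> i \in w /\ ~~ C i.
  by move=> /influence_sub_word; rewrite mem_filter => /andP[].
have ind : independent a b t'.
  apply/independentP => i j /bC[iw Ci] /t'C[jw Cj]; split; last exact: sep.
  by apply: contraNneq Cj => <-.
have Cb i : i \in w -> C i -> influence a b i.
  move=> iw Ci; apply/influence_descent => //.
  have /influence_descent-/(_ tW) := inw i iw.
  rewrite tE independent_descent //; apply: contraNneq => ->.
  rewrite add0r; apply/negPn/negP => /influence_descent-/(_ t'W)/t'C[_].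
  by rewrite Ci.
(* A path joining two points of [C] never leaves [C], so it is also a path in
   the graph induced on the influence of [b]. *)
have b_conn : induces_connected a (influence a b).
  move=> i j /bC[iw Ci] /bC[jw Cj].
  have eC : connect_sym e.
    by apply: sym_connect_sym => k l /=; rewrite adjacentC andbCA.
  have : connect e i j by rewrite -(same_connect eC Ci).
  case/connectP => p ep ->; elim: p => [|k p IHp] in i iw Ci ep *; first exact: connect0.
  move: ep => /= /andP[/and3P[ti tk ik] ep].
  have kw : k \in w by apply: winf; rewrite -in_setE.
  have Ck : C k by apply: connect_trans Ci (connect1 _); apply/and3P.
  apply: connect_trans (IHp k kw Ck ep); apply: connect1.
  by apply/and3P; split=> //; rewrite in_setE; apply: Cb.
have bi0 : influence a b i0 by apply: Cb => //; apply: connect0.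
have b1 : b <> \1%VF.
  by move=> bE; move/influence_descent: bi0 => /(_ bW); rewrite bE descent1 eqxx.
have [w' w'P] := reduced_exists t'W.
have [|l [lP lF] lE] := IH t' w' _ w'P.
  have [_ /(_ (filter (predC C) w) erefl) w's] := w'P.
  apply: leq_ltn_trans w's _; rewrite size_filter.
  apply: leq_trans (_ : (size w <= n)%N) => //.
  rewrite -(count_predC C w) -[X in (X < _)%N]add0n ltn_add2r -has_count.
  by apply/hasP; exists i0 => //; apply: connect0.
have l_sub d i : d \in l -> influence a d i -> influence a t' i.
  by move=> dl di; rewrite -lE; apply/influence_comp_list => //; exists d.
have indl d : d \in l -> independent a b d.
  move=> dl; apply/independentP => i j ib jd.
  by move/independentP: ind; apply=> //; apply: l_sub jd.
have [lu lW li] := lP.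
exists (b :: l); last by rewrite /comp_list big_cons -/(comp_list l) lE tE.
split; last by move=> d; rewrite in_cons => /orP[/eqP ->|/lF].
split=> [|d|d d']; rewrite /= ?in_cons.
- rewrite lu andbT; apply/negP => bl; have := indl b bl.
  exact: (independent_common bi0 bi0).
- by case/orP => [/eqP ->|/lW].
- case/orP => [/eqP ->|dl] /orP[/eqP ->|d'l] // dd'; first exact: indl.
    by apply: independentC; apply: indl.
  exact: li.
Qed.

(** A connected set of indices covered by sets that are pairwise disjoint and
    pairwise not joined by an edge lies in one of them. *)
Lemma connected_factor_absorbed l b : independent_list l -> connected_factor b ->
  (forall i, influence a b i -> influence a (comp_list l) i) ->
  exists2 d, d \in l & forall i, influence a b i -> influence a d i.
Proof.
move=> lP [bW b1 b_conn] cov; have [_ _ li] := lP.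
have {}cov i : influence a b i -> exists2 d, d \in l & influence a d i.
  by move=> /cov /influence_comp_list-/(_ lP).
have [i ib] := weyl_neq1 bW b1; have [d dl id] := cov i ib.
exists d => // j jb; have /connectP[p bp ->] := b_conn i j ib jb.
elim: p => [//|k p IH] in i {ib} id bp *.
move: bp => /= /andP[/and3P[_ kb ik] bp]; apply: IH bp.
rewrite in_setE in kb; have [d' d'l kd'] := cov k kb.
have [<- //|/eqP dd'] := eqVneq d' d.
have /independentP : independent a d d' by apply: li => // dE; apply: dd'.
by move=> /(_ i k id kd')[_]; rewrite ik.
Qed.

(** The connected factors of an element are determined by it: the influences of
    two families of factors are mutually included, and the descent of a factor
    is the restriction to its influence of that of the product. *)
Lemma connected_factors_sub l1 l2 : connected_factors l1 -> connected_factors l2 ->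
  comp_list l1 = comp_list l2 -> {subset l1 <= l2}.
Proof.
move=> [l1P l1F] [l2P l2F] E b bl1.
have [bW b1 _] := l1F b bl1; have [_ _ l1i] := l1P.
have inf_sub l d i : independent_list l -> d \in l -> influence a d i ->
    influence a (comp_list l) i.
  by move=> lP dl di; apply/influence_comp_list => //; exists d.
have [d dl2 bd] : exists2 d, d \in l2 & forall i, influence a b i -> influence a d i.
  apply: connected_factor_absorbed => //; first exact: l1F.
  by move=> i ib; rewrite -E; apply: inf_sub ib.
have [dW _ _] := l2F d dl2.
have [b' b'l1 db'] : exists2 d', d' \in l1 & forall i, influence a d i -> influence a d' i.
  apply: connected_factor_absorbed => //; first exact: l2F.
  by move=> i id; rewrite E; apply: inf_sub id.
have [i ib] := weyl_neq1 bW b1.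
have b'E : b' = b.
  apply: contrapT => b'b; apply: (independent_common (db' i (bd i ib)) ib).
  exact: l1i.
suff -> : b = d by [].
apply: weyl_descent_inj => // j.
have [jb|jb] := pselect (influence a b j).
  rewrite -(comp_list_descent_at l1P bl1 jb) E.
  by apply: comp_list_descent_at => //; apply: bd.
have zero x : weyl_group a x -> ~ influence a x j -> descent x j = 0.
  by move=> xW jx; apply/eqP/negPn/negP => /influence_descent-/(_ xW).
by rewrite !zero // => /db'; rewrite b'E.
Qed.

(** * Kostant's partition function and the alternation set *)

(** The height is additive and at least 1 on positive roots, so the height of
    [xi] bounds all the coefficients of a partition of [xi]. This keeps
    [kostant], a cardinal of a finite set, from taking its default value. *)
Lemma finite_partitions xi :
  finite_set [set c : {ffun positive_roots a -> nat} |
    \sum_(al : positive_roots a) val al *+ c al = xi].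
Proof.
have [[c0 c0E]|none] := pselect (exists c : {ffun positive_roots a -> nat},
    \sum_(al : positive_roots a) val al *+ c al = xi); last first.
  by apply: (@sub_finite_set _ _ set0) => // c /= cE; apply: none; exists c.
pose height v := \sum_i scoord i v.
have heightD c : height (\sum_(al : positive_roots a) val al *+ c al) =
    \sum_(al : positive_roots a) height (val al) *+ c al.
  rewrite /height; under eq_bigr do rewrite linear_sum /=.
  rewrite exchange_big; apply: eq_bigr => al _; rewrite -sumrMnl.
  by apply: eq_bigr => i _; rewrite raddfMn.
have /fin_all_exists[ht htE] (al : positive_roots a) :
    exists n : nat, height (val al) = n.+1%:R.
  have /in_positive_roots[[/eqP al0 _] [c cE]] := valP al.
  exists (\sum_i c i).-1; rewrite prednK.
    by rewrite /height natr_sum cE; apply: eq_bigr => i _; rewrite scoord_sum.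
  rewrite lt0n sum_nat_eq0; apply: contra_notN al0 => /forallP cz.
  by rewrite cE big1 // => i _; move: (cz i) => /= /eqP ->.
have xiE c : \sum_(al : positive_roots a) val al *+ c al = xi ->
    height xi = (\sum_(al : positive_roots a) (ht al).+1 * c al)%:R.
  move=> <-; rewrite heightD natr_sum; apply: eq_bigr => al _.
  by rewrite htE natrM mulr_natr.
pose N := \sum_(al : positive_roots a) (ht al).+1 * c0 al.
pose emb (f : {ffun positive_roots a -> 'I_N.+1}) : {ffun positive_roots a -> nat} :=
  [ffun al => val (f al)].
apply: (@sub_finite_set _ _ (range emb)); last first.
  by apply: finite_image; apply: finite_finset.
move=> c /= /xiE; rewrite (xiE c0 c0E) => /eqP; rewrite eqr_nat => /eqP NE.
exists [ffun al => inord (c al)] => //; apply/ffunP => al; rewrite !ffunE /= inordK //.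
rewrite ltnS /N NE (bigD1 al) //=; apply: leq_trans (leq_addr _ _).
by rewrite leq_pmull.
Qed.

(** Simple roots are positive roots, and positive roots are sums of simple
    roots. *)
Lemma kostant_gt0 xi : (0 < kostant a xi)%N <-> nat_comb xi.
Proof.
rewrite /kostant cardfs_gt0; split=> [/fset0Pn[c]|[c cE]].
  rewrite in_fset_set; last exact: finite_partitions.
  rewrite inE /= => <-; apply/nat_combP => i.
  have /fin_all_exists[n nE] (al : positive_roots a) : exists n : nat, scoord i (val al) = n%:R.
    by have /in_positive_roots[_ /nat_combP] := valP al.
  exists (\sum_(al : positive_roots a) n al * c al)%N.
  rewrite linear_sum natr_sum; apply: eq_bigr => al _ /=.
  by rewrite raddfMn /= nE natrM mulr_natr.
apply/fset0Pn; exists [ffun al : positive_roots a => \sum_(i | a i == val al) c i].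
rewrite in_fset_set; last exact: finite_partitions.
rewrite inE /= cE.
under eq_bigr => al _ do rewrite ffunE -sumrMnr.
rewrite (exchange_big_dep xpredT) //=; apply: eq_bigr => i _.
have ai : a i \in positive_roots a by apply/in_positive_roots/positive_simple.
by rewrite (big_pred1 [` ai]%fset).
Qed.

Lemma alt_setP t : alt_set a la mu t <->
  weyl_group a t /\ forall i, exists n : nat, scoord i (la - mu) = descent t i + n%:R.
Proof.
rewrite /alt_set /= kostant_gt0 nat_combP.
have E i : scoord i (t lr - mu - rho a) = scoord i (la - mu) - descent t i.
  rewrite /descent -linearB /=.
  by rewrite opprB opprD [in RHS]addrCA [in RHS]addrACA subrr add0r addrA.
split=> -[tW tn]; split=> // i; have [n nE] := tn i; exists n.
  by rewrite -nE E [RHS]addrC subrK.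
by rewrite E nE addrAC subrr add0r.
Qed.

(** Every coordinate of the descent of a product of independent elements is a
    coordinate of the descent of a factor, or zero; and the bounds given by
    [la - mu] allow zero because the alternation set is nonempty. *)
Lemma alt_set_comp_list l : alt_set a la mu !=set0 -> independent_list l ->
  alt_set a la mu (comp_list l) <-> forall t, t \in l -> alt_set a la mu t.
Proof.
move=> [t0 /alt_setP[t0W t0n]] lP; have [lW lE] := comp_list_descent lP.
have [_ ltW _] := lP.
have base i : exists n : nat, scoord i (la - mu) = n%:R.
  have [n ->] := t0n i; have [c [-> _]] := descentP t0W.
  by exists (c i + n)%N; rewrite natrD.
have zero x i : weyl_group a x -> ~ influence a x i -> descent x i = 0.
  by move=> xW ix; apply/eqP/negPn/negP => /influence_descent-/(_ xW).
split=> [/alt_setP[_ ln] t tl|lA]; apply/alt_setP; split=> //.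
- exact: ltW.
- move=> i; have [it|it] := pselect (influence a t i).
    by rewrite -(comp_list_descent_at lP tl it).
  by rewrite zero //; [have [n ->] := base i; exists n; rewrite add0r|exact: ltW].
- move=> i; have [il|il] := pselect (influence a (comp_list l) i); last first.
    by rewrite zero //; have [n ->] := base i; exists n; rewrite add0r.
  have /influence_comp_list-/(_ lP)[t tl ti] := il.
  by rewrite (comp_list_descent_at lP tl ti); have /alt_setP[_] := lA t tl.
Qed.

(** * Pairwise independent sets and their products *)

(** An index influences at most one element of [B], and every element has one. *)
Lemma finite_independent B : B `<=` connected_factor ->
  pairwise_independent a B -> finite_set B.
Proof.
move=> BF Bi.
pose owner i := xget \1%VF [set b | B b /\ influence a b i].
apply: (@sub_finite_set _ _ (range owner)).
  move=> b Bb; have [bW b1 _] := BF b Bb; have [i bi] := weyl_neq1 bW b1.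
  exists i => //; rewrite /owner; case: xgetP => [d _ [Bd di]|no].
    by apply: contrapT => db; apply: (independent_common di bi); apply: Bi.
  by case: (no b).
by apply: finite_image; apply: finite_finset.
Qed.

Lemma is_product_inj (B : set 'End(dual H)) t t' :
  is_product B t -> is_product B t' -> t = t'.
Proof.
move=> [/finite_fsetP[F FE] tP] [_ t'P].
have FB : [set` enum_fset F] = B by rewrite FE.
by rewrite -(tP _ (fset_uniq F) FB) -(t'P _ (fset_uniq F) FB).
Qed.

(** The descent of the product does not depend on the order of the factors, and
    it determines the product. *)
Lemma is_product_comp_list l : independent_list l -> is_product [set` l] (comp_list l).
Proof.
move=> lP; split=> [|l' l'u l'E]; first exact: finite_seq.
have [lu ltW li] := lP.
have mem_l t : (t \in l') = (t \in l).
  by apply/idP/idP => tl; have /seteqP[l1 l2] := l'E; [apply: l1|apply: l2].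
have l'P : independent_list l'.
  by split=> // [t|]; [rewrite mem_l; apply: ltW|rewrite l'E].
have [lW lE] := comp_list_descent lP; have [l'W l'D] := comp_list_descent l'P.
apply: weyl_descent_inj => // i; rewrite l'D lE; apply: perm_big.
exact: uniq_perm.
Qed.

Lemma independent_set_list B : B `<=` connected_factor ->
  pairwise_independent a B ->
  exists2 l, connected_factors l & [set` l] = B.
Proof.
move=> BF Bi; have /finite_fsetP[F FE] := finite_independent BF Bi.
exists (enum_fset F); last by rewrite FE.
split=> [|t tF]; last by apply: BF; rewrite FE.
split=> [|t tF|]; first exact: fset_uniq.
  by have [] : connected_factor t by apply: BF; rewrite FE.
by rewrite -[[set` _]]FE.
Qed.

Lemma is_product_listE B t : B `<=` connected_factor -> pairwise_independent a B ->
  is_product B t ->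
  exists l, [/\ connected_factors l, [set` l] = B & comp_list l = t].
Proof.
move=> BF Bi Bt; have [l lP lB] := independent_set_list BF Bi.
exists l; split=> //; apply: is_product_inj Bt; rewrite -lB.
by apply: is_product_comp_list; case: lP.
Qed.

Definition connected_alt : set 'End(dual H) :=
  [set b | alt_set a la mu b /\ connected_factor b].

(** The factors of an element of the alternation set are again in it. *)
Lemma connected_alt_basic : alt_set a la mu !=set0 -> basic_subset a la mu connected_alt.
Proof.
move=> A0; split=> [b []||b [_ []]|t tA] //; first by move=> [_ []].
have /alt_setP[tW _] := tA; have [l lP lt] := connected_factorization tW.
have [lI lF] := lP.
exists [set` l]; last by rewrite -lt; apply: is_product_comp_list.
split; last by case: lI.
move=> b bl; split; last exact: lF.
by have [+ _] := alt_set_comp_list A0 lI; rewrite lt => /(_ tA); apply.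
Qed.

(** A connected element is its own family of connected factors, hence the only
    one whose product it is. *)
Lemma basic_subset_unique S : basic_subset a la mu S -> S = connected_alt.
Proof.
move=> [SA S1 Sc Sdec].
have S_sub : S `<=` connected_alt.
  move=> b Sb; split; first exact: SA.
  split; [by have /alt_setP[] := SA b Sb|by move=> bE; rewrite bE in Sb|exact: Sc].
apply/seteqP; split=> // b [bA bF].
have [B [BS Bi] Bb] := Sdec b bA.
have BF : B `<=` connected_factor by move=> d /BS /S_sub[].
have [l [lP lB lb]] := is_product_listE BF Bi Bb.
have b1P : connected_factors [:: b].
  split=> [|t]; last by rewrite inE => /eqP ->.
  split=> // [t|t t']; first by rewrite inE => /eqP ->; case: bF.
  by rewrite /= !inE => /eqP -> /eqP ->.
apply: BS; rewrite -lB; apply: (connected_factors_sub b1P lP); last by rewrite mem_head.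
rewrite lb /comp_list big_cons big_nil.
by apply/lfunP => v; rewrite comp_lfunE id_lfunE.
Qed.

(** The product of a pairwise independent set determines the set, by uniqueness
    of the connected factors. *)
Lemma product_bijection : alt_set a la mu !=set0 ->
  exists f : set 'End(dual H) -> 'End(dual H),
    set_bij (independent_subsets a connected_alt) (alt_set a la mu) f /\
    forall B, independent_subsets a connected_alt B -> is_product B (f B).
Proof.
move=> A0; pose f (B : set 'End(dual H)) := xget \1%VF (is_product B).
have sub_factor B : B `<=` connected_alt -> B `<=` connected_factor.
  by move=> BS b /BS[].
have fP B : independent_subsets a connected_alt B -> is_product B (f B).
  move=> [/sub_factor BF Bi]; have [l [lP _] lB] := independent_set_list BF Bi.
  by apply: xgetPex; exists (comp_list l); rewrite -lB; apply: is_product_comp_list.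
have f_list B : independent_subsets a connected_alt B ->
    exists l, [/\ connected_factors l, [set` l] = B & comp_list l = f B].
  by move=> BI; have [/sub_factor BF Bi] := BI; apply: is_product_listE => //; apply: fP.
exists f; split=> //; split.
- move=> B BI; have [l [[lP _] lB <-]] := f_list B BI.
  apply/(alt_set_comp_list A0 lP) => t tl.
  by have [BS _] := BI; have [] : connected_alt t by apply: BS; rewrite -lB.
- move=> B B'; rewrite !in_setE => BI B'I fE.
  have [l [lP lB lE]] := f_list B BI; have [l' [l'P l'B l'E]] := f_list B' B'I.
  rewrite -lB -l'B; apply/seteqP; split=> t /=.
    by apply: connected_factors_sub => //; rewrite lE l'E.
  by apply: connected_factors_sub => //; rewrite lE l'E.
- move=> t tA; have [_ _ _ dec] := connected_alt_basic A0.
  have [B BI Bt] := dec t tA; exists B => //.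
  exact: is_product_inj (fP B BI) Bt.
Qed.
End Descent.

End RootSystem.

Theorem theorem3p10 (R : realType) (g : liealg R[i]) (H : {vspace g})
    (r : nat) (a : 'I_r -> dual H) (la mu : dual H) :
  lie_simple g -> cartan_subalgebra H -> simple_roots a ->
  dominant_integral a la -> integral mu ->
  alt_set a la mu !=set0 ->
  exists S : set 'End(dual H),
    [/\ basic_subset a la mu S,
        forall S', basic_subset a la mu S' -> S' = S &
        exists f : set 'End(dual H) -> 'End(dual H),
          set_bij (independent_subsets a S) (alt_set a la mu) f /\
          forall B, independent_subsets a S B -> is_product B (f B)].
Proof.
move=> simple_g cartanH simple_a dom_la _ A0.
exists (connected_alt a la mu); split.
- exact: connected_alt_basic.
- by move=> S; apply: basic_subset_unique.
- exact: product_bijection.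
Qed.
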